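(* Let $\langle\Omega,S,V,\pi\rangle$ be a bipartite monotone system with a top configuration. Let $\mathcal{A}$ be the alternating update scheme and $\mathcal{S}$ an arbitrary systematic update scheme. Then the mixing time for $\mathcal{S}$ (starting at the top state) is no more than twice the mixing time for $\mathcal{A}$; that is, for every $\varepsilon\in(0,1)$, $T_{\mathcal S}(\varepsilon)\le 2\,T_{\mathcal A}(\varepsilon)$.
   Context: A system $\langle \Omega,S,V,\pi\rangle$ consists of a finite set $S$ of spins, a finite set $V$ of $n$ sites, a set $\Omega\subseteq S^V$ of configurations, and a probability distribution $\pi$ on $\Omega$ with $\pi(\omega)>0$ for all $\omega\in\Omega$ (extended by $0$ to $S^V\setminus\Omega$). For $\sigma\in\Omega$, $v\in V$, $s\in S$, $\sigma_v^s$ is $\sigma$ with its value at $v$ changed to $s$, and $\sigma_v^\bullet=\{\sigma_v^s:s\in S\}\cap\Omega$. The update at $v$ of a distribution $\mu$ on $\Omega$ is $\mu_v(\sigma)=\frac{\pi(\sigma)}{\pi(\sigma_v^\bullet)}\mu(\sigma_v^\bullet)$. The system is monotone if $S$ is totally ordered, $S^V$ has the coordinatewise order, and whenever $\sigma\le\tau$ in $\Omega$, for every $v\in V$ the distribution $\{\pi(\sigma_v^s)/\pi(\sigma_v^\bullet)\}_{s\in S}$ on $S$ is stochastically dominated by $\{\pi(\tau_v^s)/\pi(\tau_v^\bullet)\}_{s\in S}$. The top configuration is the greatest element of $\Omega$. The system is bipartite if it is a Markov random field on a bipartite graph with vertex set $V$ (the interaction graph): for every $B\subset V$ and $\sigma\in\Omega$,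 the law of the configuration on $B$ under $\pi$ conditioned on agreeing with $\sigma$ on $V\setminus B$ depends only on the values of $\sigma$ at the vertices of $V\setminus B$ adjacent to $B$. The two sides of the bipartition are called the odd and the even sites. A systematic update scheme fixes a permutation of $V$ and updates the sites periodically in that order; one round consists of one pass through the permutation ($n$ updates). The alternating update scheme consists of repeated rounds, each of which updates all odd sites and then all even sites; a full round counts as $n$ single updates. For either scheme, $T(\varepsilon)$ is $n$ times the least number $r$ of full rounds such that, starting from the top configuration, the distribution after $r$ rounds is within total variation distance $\varepsilon$ of $\pi$. *)

(* Defs.v *)
From HB Require Import structures.
From mathcomp Require Import all_boot all_order all_algebra.
From mathcomp Require Import all_classical all_reals all_analysis.

Set Implicit Arguments.
Unset Strict Implicit.
Unset Printing Implicit Defensive.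

Import Order.TTheory GRing.Theory Num.Theory.

Local Open Scope ring_scope.

Section Systems.
Context {R : realType} {S V : finType}.

Definition config := {ffun V -> S}.

Definition weight (mu : config -> R) (A : {set config}) : R :=
  \sum_(sigma in A) mu sigma.

Record spin_system := SpinSystem {
  Omega : {set config};
  spin_pi : config -> R;
  spin_pi_gt0 : forall sigma, sigma \in Omega -> 0 < spin_pi sigma;
  spin_pi_eq0 : forall sigma, sigma \notin Omega -> spin_pi sigma = 0;
  spin_pi_weight : weight spin_pi Omega = 1
}.

Definition set_spin (sigma : config) (v : V) (s : S) : config :=
  [ffun w => if w == v then s else sigma w].

Definition fiber (X : spin_system) (sigma : config) (v : V) : {set config} :=
  [set set_spin sigma v s | s : S] :&: Omega X.

Definition site_update (X : spin_system) (v : V) (mu : config -> R) :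
    config -> R :=
  fun sigma =>
    spin_pi X sigma / weight (spin_pi X) (fiber X sigma v)
      * weight mu (fiber X sigma v).

Definition spin_law (X : spin_system) (sigma : config) (v : V) : S -> R :=
  fun s => spin_pi X (set_spin sigma v s) / weight (spin_pi X) (fiber X sigma v).

Definition agree_on (B : {set V}) (sigma : config) : {set config} :=
  [set tau : config | [forall v in B, tau v == sigma v]].

Definition cond_prob (X : spin_system) (A C : {set config}) : R :=
  weight (spin_pi X) (A :&: C) / weight (spin_pi X) C.

Definition outer_boundary (e : rel V) (B : {set V}) : {set V} :=
  [set v in ~: B | [exists u in B, e u v]].

Definition markov_random_field (X : spin_system) (e : rel V) : Prop :=
  forall (B : {set V}) (sigma tau : config),
    sigma \in Omega X -> tau \in Omega X ->
    {in outer_boundary e B, sigma =1 tau} ->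
    forall eta : config,
      cond_prob X (agree_on B eta) (agree_on (~: B) sigma) =
      cond_prob X (agree_on B eta) (agree_on (~: B) tau).

(* The odd sites are [Odd], the even sites are its complement. *)
Definition bipartition (e : rel V) (Odd : {set V}) : Prop :=
  forall u v, e u v -> (u \in Odd) != (v \in Odd).

Definition bipartite_system (X : spin_system) (e : rel V) (Odd : {set V}) :
    Prop :=
  [/\ symmetric e, bipartition e Odd & markov_random_field X e].

(* Either scheme is given by the sequence in which one round visits the
   sites. *)
Definition systematic_scheme (p : seq V) : Prop := perm_eq p (enum V).

(* The order within each side is left arbitrary: sites on one side are pairwise
   non-adjacent, so their updates commute. *)
Definition alternating_scheme (Odd : {set V}) (a : seq V) : Prop :=
  exists o e : seq V,
    [/\ perm_eq o (enum Odd), perm_eq e (enum (~: Odd)) & a = o ++ e].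

Definition run_round (X : spin_system) (p : seq V) (mu : config -> R) :
    config -> R :=
  foldl (fun nu v => site_update X v nu) mu p.

Definition point_mass (top : config) : config -> R :=
  fun sigma => (sigma == top)%:R.

Definition dist_TV (mu nu : config -> R) : R :=
  2^-1 * \sum_(sigma : config) `|mu sigma - nu sigma|.

(* The infimum of a nonempty set of naturals is its least element; it is +oo when
   the scheme never comes within eps of [spin_pi], which can happen since the
   dynamics need not be irreducible. *)
Definition mixing_time (X : spin_system) (top : config) (p : seq V) (eps : R) :
    \bar R :=
  (#|V|%:R%:E *
   ereal_inf [set r%:R%:E | r in
     [set r : nat |
       (dist_TV (iter r (run_round X p) (point_mass top)) (spin_pi X)
          <= eps)%R]])%E.

End Systems.

Arguments config : clear implicits.
Arguments spin_system : clear implicits.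

Section Monotone.
Context {R : realType} {d : Order.disp_t} {S : finOrderType d} {V : finType}.

Definition config_le (sigma tau : config S V) : Prop :=
  forall v, (sigma v <= tau v)%O.

Definition stoch_le (mu nu : S -> R) : Prop :=
  forall f : S -> R, {homo f : s t / (s <= t)%O >-> s <= t} ->
    \sum_s f s * mu s <= \sum_s f s * nu s.

Definition monotone_system (X : spin_system R S V) : Prop :=
  forall sigma tau : config S V,
    sigma \in Omega X -> tau \in Omega X -> config_le sigma tau ->
    forall v, stoch_le (spin_law X sigma v) (spin_law X tau v).

Definition top_config (X : spin_system R S V) (top : config S V) : Prop :=
  top \in Omega X /\ forall sigma, sigma \in Omega X -> config_le sigma top.

End Monotone.

(* Main.v *)
(** If [mu / pi] is increasing, an update keeps it so and moves [mu] down in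
    stochastic order; updates are moreover monotone for stochastic order, so
    omitting updates can only move the final law up. When densities are
    increasing, a lower law is closer to [pi], because the sign of [mu - pi] is
    an increasing test function. Two rounds of the systematic scheme become one
    alternating round after omitting the even sites in the first and the odd
    sites in the second: by the Markov property, updates on one side of the
    bipartition commute. *)
Require Import Defs.
From mathcomp Require Import all_boot all_order all_algebra.
From mathcomp Require Import all_classical all_reals all_analysis.
From mathcomp Require Import lra ring.
Local Open Scope ring_scope.

(** * Configurations, fibres and single-site laws *)

Section Updates.
Set Implicit Arguments.
Unset Strict Implicit.
Import Order.TTheory GRing.Theory Num.Theory.
Context {R : realType} {S V : finType}.
Variable X : spin_system R S V.
Implicit Types (sigma tau : config S V) (mu nu : config S V -> R) (u v : V).

Local Notation Om := (Omega X).
Local Notation pi := (spin_pi X).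

Definition supported mu := forall sigma, sigma \notin Om -> mu sigma = 0.

Lemma pi_ge0 sigma : 0 <= pi sigma.
Proof.
case: (boolP (sigma \in Om)) => [/(spin_pi_gt0 (s := X))/ltW//|].
by move=> /(spin_pi_eq0 (s := X)) ->.
Qed.

Lemma set_spin_id sigma v : set_spin sigma v (sigma v) = sigma.
Proof. by apply/ffunP => w; rewrite ffunE; case: eqP => [->|]. Qed.

Lemma set_spin_set sigma v s t :
  set_spin (set_spin sigma v s) v t = set_spin sigma v t.
Proof. by apply/ffunP => w; rewrite !ffunE; case: eqP. Qed.

Lemma set_spin_at sigma v s : set_spin sigma v s v = s.
Proof. by rewrite ffunE eqxx. Qed.

Lemma set_spin_neq sigma u v s : u != v -> set_spin sigma u s v = sigma v.
Proof. by rewrite ffunE eq_sym => /negPf ->. Qed.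

Lemma set_spinC sigma u v s t : u != v ->
  set_spin (set_spin sigma u s) v t = set_spin (set_spin sigma v t) u s.
Proof.
move=> uv; apply/ffunP => w; rewrite !ffunE.
by case: (w =P v) => [->|//]; rewrite eq_sym (negPf uv).
Qed.

Lemma set_spin_inj sigma v : injective (set_spin sigma v).
Proof. by move=> s t /(congr1 (fun f : config S V => f v)); rewrite !set_spin_at. Qed.

Lemma fiber_sub sigma v tau : tau \in fiber X sigma v -> tau \in Om.
Proof. by rewrite inE => /andP[]. Qed.

Lemma fiberxx sigma v : sigma \in Om -> sigma \in fiber X sigma v.
Proof.
move=> sO; rewrite inE sO andbT; apply/imsetP.
by exists (sigma v); rewrite ?set_spin_id.
Qed.

Lemma fiber_set_spin sigma v s : fiber X (set_spin sigma v s) v = fiber X sigma v.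
Proof.
by rewrite /fiber; congr (_ :&: _); apply: eq_imset => t; rewrite set_spin_set.
Qed.

Lemma fiber_eq sigma v tau :
  tau \in fiber X sigma v -> fiber X tau v = fiber X sigma v.
Proof. by rewrite inE => /andP[/imsetP[s _ ->] _]; exact: fiber_set_spin. Qed.

(** Justifies exchanging the order of summation over pairs of configurations in a common fibre. *)
Lemma fiber_sym sigma v tau :
  (sigma \in Om) && (tau \in fiber X sigma v) =
  (tau \in Om) && (sigma \in fiber X tau v).
Proof.
apply/andP/andP => -[inO F]; have := fiber_sub F; have := fiberxx v inO;
  by rewrite (fiber_eq F).
Qed.

Lemma sum_fiber sigma v mu :
  \sum_(tau in fiber X sigma v) mu tau =
  \sum_(s | set_spin sigma v s \in Om) mu (set_spin sigma v s).
Proof.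
under eq_bigl do rewrite inE.
rewrite (big_imset_cond _ (fun tau => tau \in Om) mu) //=.
by move=> s t _ _; exact: set_spin_inj.
Qed.

Lemma weight_fiber sigma v :
  weight pi (fiber X sigma v) = \sum_s pi (set_spin sigma v s).
Proof.
rewrite /weight sum_fiber big_mkcond /=; apply: eq_bigr => s _.
by case: ifPn => // /(spin_pi_eq0 (s := X)).
Qed.

Lemma weight_fiber_gt0 sigma v : sigma \in Om -> 0 < weight pi (fiber X sigma v).
Proof.
move=> sO; rewrite /weight (bigD1 sigma) ?fiberxx //=.
by rewrite ltr_pwDl ?spin_pi_gt0 // sumr_ge0 // => *; exact: pi_ge0.
Qed.

Lemma spin_law_ge0 sigma v s : 0 <= spin_law X sigma v s.
Proof. by rewrite divr_ge0 ?pi_ge0 // sumr_ge0 // => *; exact: pi_ge0. Qed.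

Lemma spin_law_eq0 sigma v s :
  set_spin sigma v s \notin Om -> spin_law X sigma v s = 0.
Proof. by move=> sO; rewrite /spin_law spin_pi_eq0 // mul0r. Qed.

(** Reads membership in [Om] off the spin law, so that locality of the law also transfers
    feasibility. *)
Lemma spin_law_gt0 sigma v s : sigma \in Om ->
  (0 < spin_law X sigma v s) = (set_spin sigma v s \in Om).
Proof.
move=> sO; case: (boolP (_ \in _)) => [tO|/spin_law_eq0->]; last by rewrite ltxx.
by rewrite divr_gt0 ?spin_pi_gt0 ?weight_fiber_gt0.
Qed.

(** * Site updates of laws and the dual heat-bath average of functions *)

Definition spin_avg v (f : config S V -> R) sigma : R :=
  \sum_s f (set_spin sigma v s) * spin_law X sigma v s.

Lemma spin_avgE v f sigma :
  spin_avg v f sigma =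
  \sum_(tau in fiber X sigma v) f tau * (pi tau / weight pi (fiber X sigma v)).
Proof.
rewrite sum_fiber [RHS]big_mkcond; apply: eq_bigr => s _ /=.
by case: ifPn => // /spin_law_eq0 ->; rewrite mulr0.
Qed.

Lemma site_update_supported v mu : supported (site_update X v mu).
Proof. by move=> sigma sO; rewrite /site_update spin_pi_eq0 // !mul0r. Qed.

Lemma run_round_supported p mu : supported mu -> supported (run_round X p mu).
Proof.
by elim: p mu => //= v p IH mu _; apply: IH; exact: site_update_supported.
Qed.

(** By reversibility, the operator that acts on test functions also acts on densities: the
    conditional expectation given the spins off [v]. *)
Lemma site_update_density v mu sigma : sigma \in Om ->
  site_update X v mu sigma / pi sigma = spin_avg v (fun tau => mu tau / pi tau) sigma.
Proof.
move=> sO; rewrite spin_avgE /site_update.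
have p0 := lt0r_neq0 (spin_pi_gt0 sO).
have -> : forall W M, pi sigma / W * M / pi sigma = M / W.
  by move=> W M; rewrite -mulrA mulrAC mulrCA mulfV // mulr1 mulrC.
rewrite /weight mulr_suml; apply: eq_bigr => tau /fiber_sub tO.
by rewrite mulrA mulfVK // lt0r_neq0 // spin_pi_gt0.
Qed.

(** Both sides are the same double sum over pairs in a common fibre, taken in opposite orders. *)
Lemma site_update_adjoint v mu f :
  \sum_(sigma in Om) f sigma * site_update X v mu sigma =
  \sum_(sigma in Om) spin_avg v f sigma * mu sigma.
Proof.
under eq_bigr do rewrite /site_update /weight mulrA mulr_sumr.
under [RHS]eq_bigr do rewrite spin_avgE mulr_suml.
rewrite (exchange_big_dep (fun tau => tau \in Om)) /=; last first.
  by move=> sigma tau _ /fiber_sub.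
apply: eq_bigr => tau tO; apply: eq_big => sigma.
  by rewrite fiber_sym tO.
by case/andP=> _ /fiber_eq ->.
Qed.

(* The fibrewise Chebyshev inequality, after symmetrising the double sum over
   pairs of configurations that differ only at [v]. *)
Lemma site_update_correlation_le v mu f :
  (forall sigma tau, sigma \in Om -> tau \in fiber X sigma v ->
     0 <= (f sigma - f tau) * (mu sigma / pi sigma - mu tau / pi tau)) ->
  \sum_(sigma in Om) f sigma * site_update X v mu sigma <=
  \sum_(sigma in Om) f sigma * mu sigma.
Proof.
move=> corr; rewrite -subr_ge0 -sumrB.
pose h sigma := mu sigma / pi sigma.
(* For [tau] in the fibre of [sigma], [k] is the joint law of a sample from [pi] and its update at
   [v]; it is symmetric, which allows the symmetrisation in [D']. *)
pose k sigma tau := pi sigma * pi tau / weight pi (fiber X sigma v).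
have pi0 sigma : sigma \in Om -> pi sigma != 0.
  by move=> sO; rewrite lt0r_neq0 // spin_pi_gt0.
have -> : \sum_(sigma in Om) (f sigma * mu sigma - f sigma * site_update X v mu sigma)
    = \sum_(sigma in Om) \sum_(tau in fiber X sigma v)
        k sigma tau * (f sigma * (h sigma - h tau)).
  apply: eq_bigr => sigma sO.
  have W0 := lt0r_neq0 (weight_fiber_gt0 v sO).
  transitivity (\sum_(tau in fiber X sigma v)
      (f sigma * mu sigma / weight pi (fiber X sigma v) * pi tau
       - f sigma * (pi sigma / weight pi (fiber X sigma v)) * mu tau)).
    by rewrite sumrB -!mulr_sumr -!/(weight _ _) divfK // -mulrA.
  apply: eq_bigr => tau /fiber_sub tO; rewrite /k /h.
  by field; rewrite W0 !pi0.
set D := (X in 0 <= X).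
have D' : D = \sum_(sigma in Om) \sum_(tau in fiber X sigma v)
    k sigma tau * (f tau * (h tau - h sigma)).
  rewrite /D (exchange_big_dep (fun tau => tau \in Om)) /=; last first.
    by move=> sigma tau _ /fiber_sub.
  apply: eq_bigr => tau tO; apply: eq_big => sigma.
    by rewrite fiber_sym tO.
  by case/andP=> _ /fiber_eq F; rewrite /k F [pi sigma * _]mulrC.
rewrite -(pmulrn_lge0 _ (isT : 0 < 2)%N) mulr2n {2}D' /D -big_split sumr_ge0 //=.
move=> sigma sO; rewrite -big_split sumr_ge0 //= => tau tF.
have -> : k sigma tau * (f sigma * (h sigma - h tau)) +
    k sigma tau * (f tau * (h tau - h sigma)) =
    k sigma tau * ((f sigma - f tau) * (h sigma - h tau)) by ring.
rewrite mulr_ge0 ?corr // divr_ge0 ?mulr_ge0 ?pi_ge0 //.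
exact/ltW/weight_fiber_gt0.
Qed.

(** * Markov property and commutation of updates at non-adjacent sites *)

Lemma site_updateE v mu sigma :
  site_update X v mu sigma = spin_law X sigma v (sigma v) *
  \sum_(s | set_spin sigma v s \in Om) mu (set_spin sigma v s).
Proof. by rewrite /site_update {2}/weight sum_fiber /spin_law set_spin_id. Qed.

Lemma agree_on_site_compl sigma v :
  agree_on (~: [set v]) sigma = [set set_spin sigma v s | s : S].
Proof.
apply/setP => tau; rewrite inE; apply/forallP/imsetP => [agr|[s _ ->] w].
  exists (tau v) => //; apply/ffunP => w; rewrite ffunE.
  case: (w =P v) => [->//|/eqP wv].
  by have := agr w; rewrite !inE wv => /eqP.
by rewrite !inE ffunE; case: (w == v) => /=.
Qed.

Lemma cond_prob_site sigma v s :
  cond_prob X (agree_on [set v] [ffun=> s]) (agree_on (~: [set v]) sigma) =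
  spin_law X sigma v s.
Proof.
rewrite /cond_prob agree_on_site_compl /spin_law weight_fiber; congr (_ / _).
  rewrite /weight (big_pred1 (set_spin sigma v s)) // => tau.
  rewrite !inE; apply/andP/eqP => [[/forallP/(_ v) + /imsetP[t _ tE]]|->].
    by rewrite inE eqxx ffunE tE set_spin_at => /eqP ->.
  split; last exact: imset_f.
  apply/forallP => w; rewrite inE; apply/implyP => /eqP ->.
  by rewrite set_spin_at ffunE.
by rewrite /weight big_imset //= => t t' _ _; exact: set_spin_inj.
Qed.

Section Markov.
Variable e : rel V.
Hypothesis Xmrf : markov_random_field X e.

(** The Markov property for the block [[set v]]: its boundary contains neither [v] nor the
    non-neighbour [u], so the two configurations agree there. *)
Lemma spin_law_local u v sigma tau : ~~ e v u ->
  sigma \in Om -> tau \in Om ->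
  (forall w, w != u -> w != v -> sigma w = tau w) ->
  spin_law X sigma v = spin_law X tau v.
Proof.
move=> evu sO tO agr; apply/funext => s; rewrite -!cond_prob_site.
apply: Xmrf => // w; rewrite !inE => /andP[wv /existsP[v' /andP[]]].
rewrite inE => /eqP -> evw; apply: agr => //.
by apply: contraNneq evu => <-.
Qed.

Lemma spin_law_set u v sigma t : ~~ e v u -> u != v ->
  sigma \in Om -> set_spin sigma u t \in Om ->
  spin_law X (set_spin sigma u t) v = spin_law X sigma v.
Proof.
move=> evu uv sO tO; apply: (spin_law_local evu) => // w wu wv.
by rewrite set_spin_neq // eq_sym.
Qed.

(** The law at [u] is the same at [sigma] and at the doubly changed configuration, and the latter
    gives positive mass to its own spin [t]. *)
Lemma set_spin2_Omega u v sigma s t : ~~ e u v -> u != v ->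
  sigma \in Om -> set_spin (set_spin sigma u t) v s \in Om ->
  set_spin sigma u t \in Om.
Proof.
move=> euv uv sO tO; rewrite -spin_law_gt0 //.
rewrite -(spin_law_local euv tO sO); last first.
  by move=> w wv wu; rewrite !set_spin_neq // eq_sym.
rewrite spin_law_gt0 // (_ : set_spin _ u t = set_spin (set_spin sigma u t) v s) //.
by rewrite -(set_spinC _ _ _ uv) set_spin_set.
Qed.

(** Brings two successive updates into a form symmetric in [u] and [v], from which commutation is
    read off. *)
Lemma site_update2E u v mu sigma :
  ~~ e u v -> ~~ e v u -> u != v -> sigma \in Om ->
  site_update X u (site_update X v mu) sigma =
  spin_law X sigma u (sigma u) * spin_law X sigma v (sigma v) *
  \sum_t \sum_(s | set_spin (set_spin sigma u t) v s \in Om)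
     mu (set_spin (set_spin sigma u t) v s).
Proof.
move=> euv evu uv sO; rewrite site_updateE -mulrA; congr (_ * _).
rewrite mulr_sumr big_mkcond; apply: eq_bigr => t _ /=.
case: ifPn => [tO|tO].
  by rewrite site_updateE spin_law_set // set_spin_neq.
(* A spin [t] infeasible at [u] stays infeasible whatever spin is put at [v], so its inner sum is
   empty. *)
rewrite big_pred0 ?mulr0 // => s; apply/negP => /(set_spin2_Omega euv uv sO).
exact/negP.
Qed.

Lemma site_updateC u v mu : ~~ e u v -> ~~ e v u ->
  site_update X u (site_update X v mu) = site_update X v (site_update X u mu).
Proof.
move=> euv evu; have [->//|uv] := eqVneq u v.
apply/funext => sigma; case: (boolP (sigma \in Om)) => sO; last first.
  by rewrite !site_update_supported.
rewrite !site_update2E //; last by rewrite eq_sym.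
rewrite [spin_law X sigma v _ * _]mulrC; congr (_ * _).
rewrite (exchange_big_dep xpredT) //=; apply: eq_bigr => s _.
by apply: eq_big => t; rewrite (set_spinC _ _ _ uv).
Qed.

Lemma run_round_site_updateC p v mu :
  (forall u, u \in p -> ~~ e u v && ~~ e v u) ->
  run_round X p (site_update X v mu) = site_update X v (run_round X p mu).
Proof.
elim: p mu => //= u p IH mu indep.
have /andP[uv vu] := indep u (mem_head _ _).
rewrite site_updateC // IH // => w wp.
by apply: indep; rewrite inE wp orbT.
Qed.

(** Induction on [p]: its head [v] splits [q] as [q1 ++ v :: q2], and the update at [v] commutes
    past all of [q1]. *)
Lemma run_round_perm (A : {pred V}) p q mu :
  {in A &, forall u v, ~~ e u v} -> {subset p <= A} -> perm_eq p q ->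
  run_round X p mu = run_round X q mu.
Proof.
move=> indep; elim: p q mu => [|v p IH] q mu pA.
  by rewrite perm_sym => /perm_nilP ->.
move=> pq; have vq : v \in q by rewrite -(perm_mem pq) mem_head.
have qA : {subset q <= A} by move=> w; rewrite -(perm_mem pq); exact: pA.
case/splitPr: vq pq qA => q1 q2 pq qA.
have pq' : perm_eq p (q1 ++ q2).
  by rewrite -(perm_cons v) (permPl pq) -cat1s perm_catCA.
have pA' : {subset p <= A} by move=> w wp; apply: pA; rewrite inE wp orbT.
rewrite [LHS](IH _ _ pA' pq') /run_round !foldl_cat /=; congr foldl.
apply: run_round_site_updateC => u uq.
by rewrite !indep //; apply: qA; rewrite mem_cat ?uq // mem_head orbT.
Qed.

End Markov.
End Updates.

(** * Increasing densities, stochastic order and censoring *)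

Section MonotoneUpdates.
Set Implicit Arguments.
Unset Strict Implicit.
Import Order.TTheory GRing.Theory Num.Theory.
Context {R : realType} {d : Order.disp_t} {S : finOrderType d} {V : finType}.
Variable X : spin_system R S V.
Hypothesis Xmono : monotone_system X.
Implicit Types (sigma tau : config S V) (mu nu f : config S V -> R) (u v : V).

Local Notation Om := (Omega X).
Local Notation pi := (spin_pi X).

Definition increasing_on_Omega f :=
  forall sigma tau, sigma \in Om -> tau \in Om -> config_le sigma tau ->
    f sigma <= f tau.

Definition increasing_density mu :=
  increasing_on_Omega (fun sigma => mu sigma / pi sigma).

Definition stoch_dom mu nu :=
  forall f, increasing_on_Omega f ->
    \sum_(sigma in Om) f sigma * mu sigma <= \sum_(sigma in Om) f sigma * nu sigma.

Lemma config_le_set_spin sigma tau v s t :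
  config_le sigma tau -> (s <= t)%O ->
  config_le (set_spin sigma v s) (set_spin tau v t).
Proof. by move=> le st w; rewrite !ffunE; case: eqP. Qed.

Lemma config_le_refl sigma : config_le sigma sigma.
Proof. by move=> v. Qed.

(* Stochastic domination of the spin laws concerns functions increasing on all
   of [S], whereas [s |-> f (set_spin sigma v s)] is increasing only on the
   allowed spins; [g] below is an increasing extension of it, and [B] is a lower
   bound for [f]. *)
Lemma spin_avg_increasing v f :
  increasing_on_Omega f -> increasing_on_Omega (spin_avg X v f).
Proof.
move=> finc sigma tau sO tO le.
pose B := - \sum_(rho : config S V) `|f rho|.
have Ble rho : B <= f rho.
  rewrite lerNl (le_trans (ler_norm _)) // normrN (bigD1 rho) //=.
  by rewrite lerDl sumr_ge0.
pose P s t := ((t <= s)%O && (set_spin sigma v t \in Om)).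
pose g s := \big[Order.max/B]_(t | P s t) f (set_spin sigma v t).
have ginc : {homo g : s t / (s <= t)%O >-> s <= t}.
  move=> s t st; apply: sub_bigmax => r /andP[rs rO].
  by rewrite /P (le_trans rs).
have gE : spin_avg X v f sigma = \sum_s g s * spin_law X sigma v s.
  apply: eq_bigr => s _; case: (boolP (set_spin sigma v s \in Om)) => sO'; last first.
    by rewrite spin_law_eq0 // !mulr0.
  congr (_ * _); apply/eqP; rewrite eq_le; apply/andP; split.
    by apply: (le_bigmax_cond _ (fun t => f (set_spin sigma v t))); rewrite /P lexx.
  apply: bigmax_le => // t /andP[ts tO']; apply: finc => //.
  exact: config_le_set_spin (config_le_refl _) ts.
rewrite gE (le_trans (Xmono sO tO le v ginc)) // ler_sum // => s _.
(* It remains to bound [g s] by [f (set_spin tau v s)]: every configuration in the maximum at [s]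
   lies below [set_spin tau v s]. *)
case: (boolP (set_spin tau v s \in Om)) => tO'; last first.
  by rewrite spin_law_eq0 // !mulr0.
rewrite ler_wpM2r ?spin_law_ge0 //.
apply: bigmax_le => // t /andP[ts sO']; apply: finc => //.
exact: config_le_set_spin.
Qed.

Lemma site_update_increasing v mu :
  increasing_density mu -> increasing_density (site_update X v mu).
Proof.
move=> /(spin_avg_increasing v) inc sigma tau sO tO le.
by rewrite !site_update_density //; exact: inc.
Qed.

Lemma run_round_increasing p mu :
  increasing_density mu -> increasing_density (run_round X p mu).
Proof.
by elim: p mu => //= v p IH mu inc; apply: IH; exact: site_update_increasing.
Qed.

Lemma stoch_dom_refl mu : stoch_dom mu mu.
Proof. by move=> f _. Qed.

Lemma stoch_dom_trans nu mu rho :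
  stoch_dom mu nu -> stoch_dom nu rho -> stoch_dom mu rho.
Proof. by move=> mn nr f inc; exact: le_trans (mn f inc) (nr f inc). Qed.

(** Adjointness moves the update onto the test function, where averaging preserves monotonicity. *)
Lemma stoch_dom_site_update v mu nu :
  stoch_dom mu nu -> stoch_dom (site_update X v mu) (site_update X v nu).
Proof.
move=> mn f inc; rewrite !site_update_adjoint.
exact/mn/spin_avg_increasing.
Qed.

(** Since [S] is totally ordered, configurations differing only at [v] are comparable, so [f] and
    the density vary in the same direction along a fibre. *)
Lemma site_update_stoch_dom v mu :
  increasing_density mu -> stoch_dom (site_update X v mu) mu.
Proof.
move=> minc f finc; apply: site_update_correlation_le => sigma tau sO tF.
have tO := fiber_sub tF.
have [le|le] : config_le sigma tau \/ config_le tau sigma.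
  move: tF; rewrite inE => /andP[/imsetP[s _ ->] _].
  rewrite -{1 4}(set_spin_id sigma v).
  case/orP: (le_total (sigma v) s) => st; [left|right];
    exact: config_le_set_spin (config_le_refl _) st.
- by rewrite mulr_le0 // subr_le0; [exact: finc|exact: minc].
- by rewrite mulr_ge0 // subr_ge0; [exact: finc|exact: minc].
Qed.

(** Induction on [p]: a kept update is applied to both laws, a dropped one only lowers [mu].
    Starting from two laws lets rounds be chained. *)
Lemma run_round_censored p c mu nu :
  subseq c p -> increasing_density mu -> stoch_dom mu nu ->
  stoch_dom (run_round X p mu) (run_round X c nu).
Proof.
elim: p c mu nu => [|v p IH] c mu nu; first by rewrite subseq0 => /eqP ->.
case: c => [|w c] /= sub inc mn.
  apply: (IH [::]); rewrite ?sub0seq //; first exact: site_update_increasing.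
  exact: stoch_dom_trans (site_update_stoch_dom v inc) mn.
move: sub; case: (w =P v) => [-> sub|_ sub].
  apply: IH => //; first exact: site_update_increasing.
  exact: stoch_dom_site_update.
apply: (IH (w :: c)) => //; first exact: site_update_increasing.
exact: stoch_dom_trans (site_update_stoch_dom v inc) mn.
Qed.

(** * Total variation distance to [pi] *)

Lemma dist_TV_stoch_dom mu nu :
  supported X mu -> increasing_density mu -> stoch_dom mu nu ->
  dist_TV mu pi <= dist_TV nu pi.
Proof.
move=> mu0 inc mn; rewrite ler_wpM2l ?invr_ge0 //.
(* On [Om], [g] is the sign of [mu - pi], with value 1 at ties; it increases because the density
   crosses 1 only upwards. *)
pose g sigma : R := if mu sigma / pi sigma < 1 then -1 else 1.
have ginc : increasing_on_Omega g.
  move=> sigma tau sO tO /(inc _ _ sO tO) le; rewrite /g.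
  case: ifPn => [_|]; first by case: ifP => _; lra.
  by rewrite -leNgt => /le_trans/(_ le); rewrite leNgt => /negPf ->.
have -> : \sum_sigma `|mu sigma - pi sigma| =
    \sum_(sigma in Om) g sigma * (mu sigma - pi sigma).
  rewrite [RHS]big_mkcond; apply: eq_bigr => sigma _ /=.
  case: ifPn => sO; last by rewrite mu0 // spin_pi_eq0 // subrr normr0.
  have p0 := spin_pi_gt0 sO.
  rewrite /g ltr_pdivrMr // mul1r; case: ltP => le.
    by rewrite ltr0_norm ?subr_lt0 // mulN1r.
  by rewrite ger0_norm ?subr_ge0 // mul1r.
(* The test function [g] attains the distance for [mu]; for [nu] it gives only a lower bound, as its
   absolute value is 1. *)
apply: (@le_trans _ _ (\sum_(sigma in Om) g sigma * (nu sigma - pi sigma))).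
  under eq_bigr do rewrite mulrBr.
  under [leRHS]eq_bigr do rewrite mulrBr.
  by rewrite !sumrB lerD2r; exact: mn.
rewrite [leLHS]big_mkcond ler_sum // => sigma _ /=.
case: ifP => // _; rewrite (le_trans (ler_norm _)) // normrM /g.
by case: ifP; rewrite ?normrN normr1 mul1r.
Qed.

Lemma point_mass_supported top : top_config X top -> supported X (point_mass top).
Proof.
move=> [topO _] sigma; rewrite /point_mass.
by case: eqP => // ->; rewrite topO.
Qed.

(** Within [Om] only [top] itself lies above [top]. *)
Lemma point_mass_increasing top :
  top_config X top -> increasing_density (point_mass top).
Proof.
move=> [topO topP] sigma tau sO tO le; rewrite /point_mass.
have [E|_] := eqVneq sigma top; last first.
  by rewrite mul0r divr_ge0 // pi_ge0.
rewrite (_ : tau = top) ?E ?eqxx //; apply/ffunP => v.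
by apply/le_anti; rewrite topP // -E le.
Qed.

(** * Comparison of the systematic and alternating schemes *)

Section Schemes.
Variables (e : rel V) (Odd : {set V}) (a s : seq V).
Hypothesis Xbip : bipartite_system X e Odd.
Hypothesis a_alt : alternating_scheme Odd a.
Hypothesis s_sys : systematic_scheme s.

Lemma same_side_nonadjacent u v : (u \in Odd) = (v \in Odd) -> ~~ e u v.
Proof.
case: Xbip => _ bip _ uv; apply/negP => /bip.
by rewrite uv eqxx.
Qed.

Lemma scheme_side (A : {set V}) p :
  perm_eq p (enum A) -> perm_eq p [seq v <- s | v \in A].
Proof.
move=> /permPl ->; apply: uniq_perm => [||v]; first exact: enum_uniq.
  by rewrite filter_uniq // (perm_uniq s_sys) enum_uniq.
by rewrite mem_enum mem_filter (perm_mem s_sys) mem_enum andbT.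
Qed.

(** Reorders one side as [s] visits it, so that half of an alternating round becomes a subsequence
    of [s]. *)
Lemma run_round_side (A : {set V}) p mu :
  {in A &, forall u v, (u \in Odd) = (v \in Odd)} -> perm_eq p (enum A) ->
  run_round X p mu = run_round X [seq v <- s | v \in A] mu.
Proof.
case: Xbip => _ _ mrf side pA; apply: (run_round_perm mrf (A := A)).
- by move=> u v uA vA; apply: same_side_nonadjacent; exact: side.
- by move=> v; rewrite (perm_mem pA) mem_enum.
- exact: scheme_side.
Qed.

Lemma two_rounds_stoch_dom mu nu :
  increasing_density mu -> stoch_dom mu nu ->
  stoch_dom (run_round X s (run_round X s mu)) (run_round X a nu).
Proof.
move=> inc mn; case: a_alt => o [p [po pp ->]].
rewrite [run_round X (o ++ p) nu]foldl_cat.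
rewrite -[foldl _ _ o]/(run_round X o nu) -[foldl _ _ p]/(run_round X p _).
rewrite (run_round_side _ _ po); last by move=> u v -> ->.
rewrite (run_round_side _ _ pp); last first.
  by move=> u v; rewrite !inE => /negPf -> /negPf ->.
(* The outer use censors the odd sites of the second systematic round, the next one the even sites
   of the first. *)
apply: run_round_censored; [exact: filter_subseq|exact: run_round_increasing|].
by apply: run_round_censored; first exact: filter_subseq.
Qed.

Lemma iter_run_round_increasing top r : top_config X top ->
  increasing_density (iter r (run_round X s) (point_mass top)).
Proof.
move=> Xtop; elim: r => [|r IH]; first exact: point_mass_increasing.
exact: run_round_increasing.
Qed.

Lemma iter_run_round_supported top r : top_config X top ->
  supported X (iter r (run_round X s) (point_mass top)).
Proof.
move=> Xtop; elim: r => [|r IH]; first exact: point_mass_supported.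
exact: run_round_supported.
Qed.

Lemma iter_double_stoch_dom top r : top_config X top ->
  stoch_dom (iter r.*2 (run_round X s) (point_mass top))
    (iter r (run_round X a) (point_mass top)).
Proof.
move=> Xtop; elim: r => [|r IH]; first exact: stoch_dom_refl.
rewrite doubleS; apply: two_rounds_stoch_dom => //.
exact: iter_run_round_increasing.
Qed.

Lemma dist_TV_double top r : top_config X top ->
  dist_TV (iter r.*2 (run_round X s) (point_mass top)) pi <=
  dist_TV (iter r (run_round X a) (point_mass top)) pi.
Proof.
move=> Xtop; apply: dist_TV_stoch_dom.
- exact: iter_run_round_supported.
- exact: iter_run_round_increasing.
- exact: iter_double_stoch_dom.
Qed.

End Schemes.
End MonotoneUpdates.

Theorem theorem3p1 (R : realType) (d : Order.disp_t) (S : finOrderType d)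
    (V : finType) (X : spin_system R S V) (e : rel V) (Odd : {set V})
    (top : config S V) (a s : seq V) (eps : R)
    (Xmono : monotone_system X)
    (Xbip : bipartite_system X e Odd)
    (Xtop : top_config X top)
    (a_alt : alternating_scheme Odd a)
    (s_sys : systematic_scheme s)
    (eps_gt0 : 0 < eps) (eps_lt1 : eps < 1) :
  (mixing_time X top s eps <= 2%:E * mixing_time X top a eps)%E.
Proof.
rewrite /mixing_time muleCA lee_wpmul2l ?lee_fin ?Num.Theory.ler0n //.
(* Moving the factor 2 to the left leaves a lower bound to check on each admissible [r] of the
   alternating scheme; [r.*2] is then admissible for the systematic one. An empty set of such [r] is
   covered too. *)
rewrite -lee_pdivrMl ?Num.Theory.ltr0n //; apply/ereal_infP => _ [r rP <-].
rewrite lee_pdivrMl ?Num.Theory.ltr0n // -EFinM -GRing.natrM mul2n.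
apply: ereal_inf_lbound; exists r.*2 => //.
exact: Order.POrderTheory.le_trans (dist_TV_double Xmono Xbip a_alt s_sys r Xtop) rP.
Qed.
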